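(* Let $\mathcal{R}>0$, $\alpha>0$, $\beta>0$ be fixed, and let $\bar\gamma_{\mathrm{D}}>0$ with $\bar\gamma_{\mathrm{R}}=\alpha\bar\gamma_{\mathrm{D}}$ and $\bar\gamma_{\mathrm{E}}=\bar\gamma_{\mathrm{R}}/\beta$. Let $h_{\mathrm{S},\mathrm{R}},h_{\mathrm{R},\mathrm{D}},h_{\mathrm{S},\mathrm{E}}$ be independent $\mathcal{CN}(0,1)$ random variables, and define $$\mathcal{R}^{2}_{\mathrm{S}\to\mathrm{R}}=\log_2\frac{1+\bar\gamma_{\mathrm{R}}|h_{\mathrm{S},\mathrm{R}}|^2}{1+\bar\gamma_{\mathrm{E}}|h_{\mathrm{S},\mathrm{E}}|^2},\qquad \mathcal{R}^{2}_{\mathrm{R}\to\mathrm{D}}=\log_2\left(1+\bar\gamma_{\mathrm{D}}|h_{\mathrm{R},\mathrm{D}}|^2\right),$$ $\mathcal{R}_2=\max\{\min\{\mathcal{R}^{2}_{\mathrm{S}\to\mathrm{R}},\mathcal{R}^{2}_{\mathrm{R}\to\mathrm{D}}\},0\}$ and $\mathcal{P}_2=\Pr(\mathcal{R}_2<\mathcal{R})$. Then as $\bar\gamma_{\mathrm{D}}\to\infty$, $$\mathcal{P}_2\approx\mathcal{P}_2^{\lim}+\hat{\mathcal{M}}_2\bar\gamma_{\mathrm{D}}^{-1},$$ in the sense that $\mathcal{P}_2\to\mathcal{P}_2^{\lim}$ and $\bar\gamma_{\mathrm{D}}(\mathcal{P}_2-\mathcal{P}_2^{\lim})\to\hat{\mathcal{M}}_2$,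 where $$\mathcal{P}_2^{\lim}=1-\frac{1}{1+\frac{1}{\beta}2^{\mathcal{R}}},\qquad \hat{\mathcal{M}}_2=\frac{(2^{\mathcal{R}}-1)(1+1/\alpha)}{1+\frac{1}{\beta}2^{\mathcal{R}}}.$$
   Context: $\mathcal{CN}(0,1)$ denotes a circularly symmetric complex Gaussian random variable with zero mean and unit variance (Rayleigh fading). The quantities model a decode-and-forward relay system where the eavesdropper overhears only the source; $\bar\gamma$'s are average SNRs, $\mathcal{R}_2$ the secrecy capacity and $\mathcal{P}_2$ the secrecy outage probability. *)

(* Defs.v *)
From HB Require Import structures.
From mathcomp Require Import all_boot all_order all_algebra.
From mathcomp Require Import all_classical all_reals all_analysis.
Set Implicit Arguments. Unset Strict Implicit. Unset Printing Implicit Defensive.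
Import Order.TTheory GRing.Theory Num.Theory.
Import numFieldNormedType.Exports.
Local Open Scope classical_set_scope.
Local Open Scope ring_scope.

(* Index of the three links: 0 = (S,R), 1 = (R,D), 2 = (S,E).
   A complex channel coefficient h_i is given by its real part X (i,false)
   and imaginary part X (i,true). *)
Definition hSR : 'I_3 := inord 0.
Definition hRD : 'I_3 := inord 1.
Definition hSE : 'I_3 := inord 2.

Section model.
Context {d : measure_display} {T : measurableType d} {R : realType}.

(* Mutual independence of a finite family of real random variables:
   product rule for every choice of Borel sets (taking some sets equal to
   setT yields the product rule for every subfamily). *)
Definition mutually_independent (I : finType) (P : probability T R)
  (X : I -> T -> R) : Prop :=
  (forall i, measurable_fun setT (X i)) /\
  forall A : I -> set R, (forall i, measurable (A i)) ->
    P (\bigcap_(i in setT) (X i @^-1` A i)) =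
    (\prod_(i : I) P (X i @^-1` A i))%E.

Definition has_normal_law (P : probability T R) (m v : R) (Y : T -> R) : Prop :=
  forall A : set R, measurable A ->
    P (Y @^-1` A) = normal_prob m (Num.sqrt v) A.

(* The channel coefficients h_i = X(i,false) + j X(i,true), i : 'I_3, are
   independent CN(0,1): their real and imaginary parts are six mutually
   independent N(0,1/2) real random variables. *)
Definition indep_CN01 (P : probability T R) (X : 'I_3 * bool -> T -> R) : Prop :=
  mutually_independent P X /\
  forall k, has_normal_law P 0 (2^-1) (X k).

Definition hsq (X : 'I_3 * bool -> T -> R) (i : 'I_3) (t : T) : R :=
  X (i, false) t ^+ 2 + X (i, true) t ^+ 2.

Definition log2 (x : R) : R := ln x / ln 2.

Definition R2 (alpha beta gD : R) (X : 'I_3 * bool -> T -> R) (t : T) : R :=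
  let gR := alpha * gD in
  let gE := gR / beta in
  let rSR := log2 ((1 + gR * hsq X hSR t) / (1 + gE * hsq X hSE t)) in
  let rRD := log2 (1 + gD * hsq X hRD t) in
  Num.max (Num.min rSR rRD) 0.

Definition P2 (P : probability T R) (Rth alpha beta gD : R)
  (X : 'I_3 * bool -> T -> R) : R :=
  fine (P [set t | R2 alpha beta gD X t < Rth]).

End model.

Definition P2lim {R : realType} (Rth beta : R) : R :=
  1 - 1 / (1 + beta^-1 * (2 `^ Rth)).

Definition M2hat {R : realType} (Rth alpha beta : R) : R :=
  ((2 `^ Rth - 1) * (1 + alpha^-1)) / (1 + beta^-1 * (2 `^ Rth)).

(* Main.v *)
Require Import Defs.
From HB Require Import structures.
From mathcomp Require Import all_boot all_order all_algebra.
From mathcomp Require Import all_classical all_reals all_analysis.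
From mathcomp Require Import measurable_realfun ring lra.
Import Order.TTheory GRing.Theory Num.Theory.
Import numFieldNormedType.Exports.
Local Open Scope classical_set_scope.
Local Open Scope ring_scope.

(** With rates rewritten as SNR conditions, non-outage is the event
    [|h_SR|^2 >= s + k |h_SE|^2] and [|h_RD|^2 >= c], where [b = 2^Rth],
    [s = (b - 1) / (alpha gD)], [k = b / beta] and [c = (b - 1) / gD].  Each
    [|h|^2] is a unit exponential variable, so by independence the event has
    probability [e^-(s + c) E(e^(-k |h_SE|^2)) = e^-(s + c) / (1 + k)],
    an exact formula from which both limits follow.

    The exponential law is derived without polar coordinates: substituting
    [y = x t] and then [x = u / sqrt (1 + t^2)] in [int int g (x^2 + y^2)]
    leaves [int (1 + t^2)^-1 dt * int |u| g (u^2) du], and the first factor is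
    determined by the total mass of the Gaussian. *)

(** * Linear changes of variable for Lebesgue measure and integral *)

Section lebesgue_scaling.
Context {R : realType}.
Local Notation mu := (@lebesgue_measure R).
Local Open Scope ereal_scope.

Let scale_preimage (c a b : R) : (0 < c)%R ->
  ( *%R c : R -> measurableTypeR R) @^-1` `]a, b]%classic =
  `](a / c)%R, (b / c)%R]%classic.
Proof.
by move=> c0; apply/seteqP; split => x /=;
  rewrite !in_itv/= ltr_pdivrMr// ler_pdivlMr// mulrC.
Qed.

(** Uniqueness of Lebesgue measure: the pushforward under multiplication by [c], rescaled by [c],
    gives every half-open interval its length. *)
Lemma lebesgue_measure_scale (c : R) (A : set R) : (0 < c)%R -> measurable A ->
  mu A = c%:E * mu ( *%R c @^-1` A).
Proof.
move=> c0 mA.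
have mc : measurable_fun setT ( *%R c : measurableTypeR R -> measurableTypeR R)
  by exact: measurable_funM.
pose m : {measure set (measurableTypeR R) -> \bar R} :=
  mscale (NngNum (ltW c0)) (pushforward mu ( *%R c : R -> measurableTypeR R)).
rewrite (@lebesgue_measure_unique _ (m mc))//= => _ [[a b]] _ <-.
rewrite /m /mscale/= /pushforward scale_preimage// !lebesgue_measure_itv/=.
rewrite !lte_fin ltr_pM2r ?invr_gt0//; case: ifPn => _; last by rewrite mule0.
by rewrite -!EFinB -EFinM -mulrBl mulrCA divff ?mulr1// gt_eqF.
Qed.

Lemma ge0_integral_scale_gt0 (c : R) (f : R -> \bar R) : (0 < c)%R ->
  measurable_fun setT f -> (forall x, 0 <= f x) ->
  \int[mu]_x f x = c%:E * \int[mu]_x f (c * x)%R.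
Proof.
move=> c0 mf f0.
have mc : measurable_fun setT ( *%R c : measurableTypeR R -> measurableTypeR R)
  by exact: measurable_funM.
rewrite -(ge0_integral_pushforward mc mu measurableT mf)//.
rewrite -[in RHS](_ : (NngNum (ltW c0))%:num = c)//.
pose m : {measure set (measurableTypeR R) -> \bar R} :=
  pushforward mu ( *%R c : R -> measurableTypeR R).
rewrite -(ge0_integral_mscale (m mc))//.
by apply: eq_measure_integral => A mA _; exact: lebesgue_measure_scale.
Qed.

Lemma ge0_integral_opp (f : R -> \bar R) :
  measurable_fun setT f -> (forall x, 0 <= f x) ->
  \int[mu]_x f x = \int[mu]_x f (- x)%R.
Proof.
move=> mf f0.
rewrite -(ge0_integral_pushforward
  (phi := -%R : measurableTypeR R -> measurableTypeR R) _ mu measurableT mf)//.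
by apply: eq_measure_integral => A mA _; exact/esym/lebesgue_measureN.
Qed.

(** Negative factors are needed because the substitution [y = x t] is made for every nonzero real
    [x]; they reduce to positive ones by reflection. *)
Lemma ge0_integral_scale (c : R) (f : R -> \bar R) : c != 0%R ->
  measurable_fun setT f -> (forall x, 0 <= f x) ->
  \int[mu]_x f x = `|c|%:E * \int[mu]_x f (c * x)%R.
Proof.
move=> c0 mf f0; have [cn|cp|c00] := ltgtP c 0%R;
  last by rewrite c00 eqxx in c0.
- rewrite ltr0_norm// ge0_integral_opp//.
  rewrite (@ge0_integral_scale_gt0 (- c)) ?oppr_gt0//.
    by under eq_integral do rewrite mulNr opprK.
  by apply: measurableT_comp => //; exact: measurable_oppr.
- by rewrite gtr0_norm//; exact: ge0_integral_scale_gt0.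
Qed.

End lebesgue_scaling.

(** The Radon-Nikodym derivative of the normal law and the explicit density have the same integral
    over every measurable set, hence agree almost everywhere. *)
Lemma ge0_integral_normal_prob {R : realType} (m s : R) (f : R -> \bar R) :
  measurable_fun setT f -> (forall x, 0 <= f x)%E ->
  (\int[normal_prob m s]_x f x =
   \int[lebesgue_measure]_x (f x * (normal_pdf m s x)%:E))%E.
Proof.
move=> mf f0; have dom := normal_prob_dominates m s.
rewrite -(Radon_Nikodym_SigmaFinite.change_of_variables dom f0 measurableT mf).
have mpdf : measurable_fun setT (fun x => (normal_pdf m s x)%:E).
  by apply/measurable_EFinP; exact: measurable_normal_pdf.
have iRN := Radon_Nikodym_SigmaFinite.f_integrable dom.
apply: ae_eq_integral => //.
- by apply: emeasurable_funM => //; exact: measurable_int iRN.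
- exact: emeasurable_funM.
- apply: ae_eqe_mul2l; apply: integral_ae_eq => //.
  by move=> E _ mE; rewrite -Radon_Nikodym_SigmaFinite.f_integral.
Qed.

Lemma sqnorm_measurable {R : realType} : measurable_fun setT
  (fun z : measurableTypeR R * measurableTypeR R => z.1 ^+ 2 + z.2 ^+ 2).
Proof. by apply: measurable_funD; exact: measurable_funX. Qed.

(** * Integrals of radial functions over the plane *)

Section radial_integrals.
Context {R : realType}.
Local Notation mu := (@lebesgue_measure R).
Local Open Scope ereal_scope.

Lemma ge0_integral_even (f : R -> \bar R) : measurable_fun setT f ->
  (forall x, 0 <= f x) -> (forall x, f (- x)%R = f x) ->
  \int[mu]_x f x = 2%:E * \int[mu]_(x in `[0%R, +oo[) f x.
Proof.
move=> mf f0 fN.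
rewrite -(setUv `[0%R, +oo[%classic) ge0_integral_setU//=; last 3 first.
  exact: measurableC.
  by rewrite setUv.
  exact/disj_setPCl.
rewrite mule_natl mule2n; congr +%E.
rewrite setCitvr integral_itv_bndo_bndc; last exact: measurable_funTS.
rewrite ge0_integration_by_substitution0//.
by under [RHS]eq_integral do rewrite fN.
Qed.

(** One computation for three uses: [a = 1] gives the exponential tail, [s = 0] with [a = 1 + k] the
    Laplace transform, and [a = 1], [s = 0] the total mass. *)
Lemma integral_normM_expRN_sqr_tail (a s : R) : (0 < a)%R -> (0 <= s)%R ->
  \int[mu]_u (`|u| * (expR (- a * u ^+ 2) * \1_`[s, +oo[ (u ^+ 2)))%:E
  = (expR (- a * s) / a)%:E.
Proof.
move=> a0 s0; rewrite ge0_integral_even; last 3 first.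
- apply/measurable_EFinP; apply: measurable_funM => //.
  apply: measurable_funM; last exact: measurableT_comp.
  by apply: measurableT_comp => //; exact: measurable_funM.
- by move=> x; rewrite lee_fin !mulr_ge0 ?expR_ge0.
- by move=> x; rewrite normrN sqrrN.
(* [F] is the antiderivative of [f] that vanishes at infinity, so the integral of [f] from
   [Num.sqrt s] on is [- F (Num.sqrt s)]. The factor 2 from evenness cancels the 2 in [F]. *)
pose f x := (x * expR (- a * x ^+ 2))%R.
pose F x := (- (2 * a)^-1 * expR (- a * x ^+ 2))%R.
have dF x : is_derive x (1%R : R) F (f x).
  apply: is_derive_eq; rewrite /f /GRing.scale/=.
  by field; rewrite gt_eqF.
have cf : continuous f.
  move=> x; apply/differentiable_continuous/derivable1_diffP; exact: ex_derive.
transitivity (2%:E * \int[mu]_(x in `[Num.sqrt s, +oo[) (f x)%:E).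
  congr *%E; rewrite [LHS]integral_mkcond [RHS]integral_mkcond.
  apply: eq_integral => x _; rewrite !patchE.
  have -> : (x \in `[Num.sqrt s, +oo[%classic) =
      (x \in `[0%R, +oo[%classic) && (s <= x ^+ 2)%R.
    rewrite !mem_setE !in_itv/= !andbT.
    have [x0|x0] := leP 0%R x => /=.
      by rewrite -[in RHS](sqr_sqrtr s0) ler_sqr ?nnegrE ?sqrtr_ge0.
    by apply/negbTE; rewrite -ltNge (lt_le_trans x0)// sqrtr_ge0.
  rewrite mem_setE in_itv/= andbT; have [x0/=|//] := leP 0%R x.
  rewrite indicE mem_setE in_itv/= andbT (ger0_norm x0).
  by case: ifPn => _; rewrite ?mulr1 ?mulr0.
rewrite (@ge0_continuous_FTC2y _ f F _ 0%R)//.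
- rewrite sub0e -EFinN -EFinM; congr EFin; rewrite /F sqr_sqrtr//.
  by field; rewrite gt_eqF.
- move=> x sx; rewrite mulr_ge0 ?expR_ge0// (le_trans _ sx)// sqrtr_ge0.
- exact: continuous_subspaceT.
- rewrite -[X in _ --> X](mulr0 (- (2 * a)^-1)%R); apply: cvgMr.
  rewrite [X in X @ _ --> _](_ : _ =
    (fun z => expR (- z)) \o (fun z => a * z)%R \o (fun z => z ^+ 2)%R);
    last first.
    by apply/funext => x /=; rewrite mulNr.
  apply: cvg_comp; first exact: cvgr_expr2.
  apply: cvg_comp; last exact: cvgr_expR.
  exact: gt0_cvgMry.
- apply: cvg_at_right_filter.
  apply/differentiable_continuous/derivable1_diffP; exact: ex_derive.
- by move=> x _; rewrite derive1E; exact: derive_val.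
Qed.

Lemma ge0_integral_radial (g : R -> R) :
  measurable_fun setT g -> (forall r, 0 <= g r)%R ->
  \int[mu]_x \int[mu]_y (g (x ^+ 2 + y ^+ 2))%:E =
  \int[mu]_t ((1 + t ^+ 2)^-1)%:E * \int[mu]_u (`|u| * g (u ^+ 2))%:E.
Proof.
move=> mg g0.
(* The integrand after [y = x t], with [z = (x, t)]; the factor [|x|] is the Jacobian. *)
pose h (z : measurableTypeR R * measurableTypeR R) :=
  (`|z.1| * g (z.1 ^+ 2 * (1 + z.2 ^+ 2)))%:E.
have mh : measurable_fun setT h.
  apply/measurable_EFinP; apply: measurable_funM; first exact: measurableT_comp.
  apply: measurableT_comp => //; apply: measurable_funM.
    exact: measurable_funX.
  by apply: measurable_funD => //; exact: measurable_funX.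
have h0 z : 0 <= h z by rewrite lee_fin mulr_ge0.
pose k (z : measurableTypeR R * measurableTypeR R) :=
  (g (z.1 ^+ 2 + z.2 ^+ 2))%:E.
have mk : measurable_fun setT k.
  apply/measurable_EFinP; apply: measurableT_comp => //.
  by apply: measurable_funD => //; exact: measurable_funX.
have k0 z : 0 <= k z by rewrite lee_fin.
have mgu : measurable_fun setT (fun u : R => (`|u| * g (u ^+ 2))%:E).
  apply/measurable_EFinP; apply: measurable_funM => //.
  exact: measurableT_comp.
transitivity (\int[mu]_x \int[mu]_t h (x, t)).
  apply: (@ge0_ae_eq_integral _ _ _ mu setT) => //.
  - exact: (measurable_fun_fubini_tonelli_F (m2 := mu) k mk k0).
  - exact: (measurable_fun_fubini_tonelli_F (m2 := mu) h mh h0).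
  - by move=> x _; apply: integral_ge0 => y _; exact: (k0 (x, y)).
  - by move=> x _; apply: integral_ge0 => y _; exact: h0.
  (* The substitution [y = x t] degenerates at [x = 0], a null set, so the inner integrals need only
     agree for almost every [x]. *)
  - exists [set 0%R]; split => //; first by rewrite /mu/= lebesgue_measure_set1.
    move=> x /=; apply: contra_notP => /eqP x0 _.
    rewrite (@ge0_integral_scale _ x)//; last 2 first.
      apply/measurable_EFinP; apply: measurableT_comp => //.
      exact: measurable_funD.
      by move=> y; rewrite lee_fin.
    rewrite -ge0_integralZl//; last 2 first.
      apply/measurable_EFinP; apply: measurableT_comp => //.
      apply: measurable_funD => //; apply: measurable_funX.
      exact: measurable_funM.
      by move=> y _; rewrite lee_fin.
    apply: eq_integral => t _; rewrite /h/= -EFinM.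
    by rewrite exprMn mulrDr mulr1.
(* With [t] now outermost, [x] can be rescaled by a constant that depends on [t]. *)
rewrite (fubini_tonelli (m1 := mu) (m2 := mu))//.
rewrite -ge0_integralZr//; last 3 first.
- apply/measurable_EFinP; apply: continuous_measurable_fun.
  exact: continuous_oneDsqrV.
- by move=> t _; rewrite lee_fin invr_ge0 addr_ge0 ?sqr_ge0.
- by apply: integral_ge0 => u _; rewrite lee_fin mulr_ge0.
apply: eq_integral => t _.
have t0 : (0 < 1 + t ^+ 2)%R by rewrite ltr_pwDl// sqr_ge0.
(* Putting [x = c u] turns the argument of [g] into [u ^+ 2]. One factor [c] comes from the Jacobian
   and one from [|x|], whence the weight [c ^+ 2]. *)
set c := (Num.sqrt (1 + t ^+ 2))^-1%R.
have c0 : (0 < c)%R by rewrite invr_gt0 sqrtr_gt0.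
have c2 : (c ^+ 2 = (1 + t ^+ 2)^-1)%R by rewrite exprVn sqr_sqrtr// ltW.
rewrite [LHS](@ge0_integral_scale_gt0 _ c)//; last first.
  apply/measurable_EFinP; apply: measurable_funM => //.
  by apply: measurableT_comp => //=; apply: measurable_funM => //;
    exact: measurable_funX.
rewrite -c2 expr2 EFinM -muleA; congr *%E.
rewrite -ge0_integralZl//; last 2 first.
  by move=> u _; rewrite lee_fin mulr_ge0.
  by rewrite lee_fin ltW.
apply: eq_integral => u _; rewrite /h/= -EFinM; congr EFin.
rewrite normrM (gtr0_norm c0) -mulrA; congr (_ * (_ * g _))%R.
by rewrite exprMn c2; field; rewrite gt_eqF.
Qed.

End radial_integrals.

(** * The squared modulus of a complex Gaussian *)

Section complex_gaussian.
Context {R : realType}.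
Local Notation mu := (@lebesgue_measure R).
Local Notation nu := (normal_prob (0 : R) (Num.sqrt 2^-1)).
Local Notation nu2 := (nu \x nu)%E.
Local Open Scope ereal_scope.

Lemma normal_pdf_half (x : R) :
  normal_pdf 0 (Num.sqrt 2^-1) x = ((Num.sqrt pi)^-1 * expR (- x ^+ 2))%R.
Proof.
have s2 : (Num.sqrt 2^-1 ^+ 2 = 2^-1 :> R)%R by rewrite sqr_sqrtr// invr_ge0.
rewrite normal_pdfE; last by rewrite gt_eqF// sqrtr_gt0 invr_gt0.
rewrite /normal_peak /normal_fun s2 subr0.
by congr (_^-1 * expR _)%R; [congr Num.sqrt; field | field].
Qed.

(** The joint density depends on the squared modulus alone, so the radial formula applies. Its
    angular factor is never evaluated: [key] carries it as a constant, and the case of the constant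
    function 1 shows that, divided by [pi], it equals 1. *)
Lemma ge0_integral_normal_pair_radial (g : R -> R) :
  measurable_fun setT g -> (forall r, 0 <= g r)%R ->
  \int[nu \x nu]_z (g (z.1 ^+ 2 + z.2 ^+ 2))%:E =
  \int[mu]_u (`|u| * (expR (- u ^+ 2) * g (u ^+ 2)))%:E.
Proof.
have key (k : R -> R) : measurable_fun setT k -> (forall r, 0 <= k r)%R ->
    \int[nu \x nu]_z (k (z.1 ^+ 2 + z.2 ^+ 2))%:E =
    \int[mu]_t ((1 + t ^+ 2)^-1)%:E * (pi^-1%:E *
    \int[mu]_u (`|u| * (expR (- u ^+ 2) * k (u ^+ 2)))%:E).
  move=> mk k0.
  pose h (z : measurableTypeR R * measurableTypeR R) :=
    (k (z.1 ^+ 2 + z.2 ^+ 2))%:E.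
  have h0 z : 0 <= h z by rewrite lee_fin.
  have mh : measurable_fun setT h.
    apply/measurable_EFinP; apply: measurableT_comp => //.
    by apply: measurable_funD => //; exact: measurable_funX.
  rewrite (fubini_tonelli1 h mh h0).
  (* The product of the two densities is [pi^-1 * expR (- r)] at [r = x ^+ 2 + y ^+ 2]; [G] absorbs
     it into the integrand. *)
  pose G r : R := (pi^-1 * (expR (- r) * k r))%R.
  have G0 r : (0 <= G r)%R by rewrite !mulr_ge0 ?expR_ge0// invr_ge0 pi_ge0.
  have mG : measurable_fun setT G.
    apply: measurable_funM => //; apply: measurable_funM => //.
    exact: measurableT_comp.
  transitivity (\int[mu]_x \int[mu]_y (G (x ^+ 2 + y ^+ 2))%:E).
    rewrite ge0_integral_normal_prob//; last 2 first.
    + exact: (measurable_fun_fubini_tonelli_F (m2 := nu) h mh h0).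
    + by move=> x; exact: integral_ge0.
    apply: eq_integral => x _.
    have mhx : measurable_fun setT (fun y => h (x, y)).
      apply/measurable_EFinP; apply: measurableT_comp => //=.
      exact: measurable_funD.
    rewrite /fubini_F (ge0_integral_normal_prob _ _ _ mhx)//.
    rewrite -ge0_integralZr//; last 3 first.
    + apply: emeasurable_funM => //; apply/measurable_EFinP.
      exact: measurable_normal_pdf.
    + by move=> y _; rewrite mule_ge0// lee_fin normal_pdf_ge0.
    + by rewrite lee_fin normal_pdf_ge0.
    apply: eq_integral => y _; rewrite !normal_pdf_half -!EFinM /G; congr EFin.
    rewrite opprD expRD -[in RHS](sqr_sqrtr (pi_ge0 R)).
    by field; rewrite gt_eqF// sqrtr_gt0 pi_gt0.
  rewrite ge0_integral_radial//; congr *%E.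
  rewrite -ge0_integralZl//; last 3 first.
  + apply/measurable_EFinP; apply: measurable_funM => //.
    apply: measurable_funM; last exact: measurableT_comp.
    by apply: measurableT_comp => //; exact: measurable_funN.
  + by move=> u _; rewrite lee_fin !mulr_ge0 ?expR_ge0.
  + by rewrite lee_fin invr_ge0 pi_ge0.
  by apply: eq_integral => u _; rewrite -EFinM /G mulrCA.
(* Apply [key] to the constant 1: the left side is the mass of a probability, and the radial
   integral is the tail formula at [a = 1], [s = 0], whose indicator is 1 at every square. *)
have C1 : \int[mu]_t ((1 + t ^+ 2)^-1)%:E * pi^-1%:E = 1.
  have := key (cst 1%R) (measurable_cst _) (fun=> ler01).
  rewrite [X in _ = _ * (_ * X)](_ : _ = 1); last first.
    rewrite -[RHS](_ : (expR (- 1 * 0) / 1)%:E = _); last first.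
      by rewrite mulr0 expR0 divr1.
    rewrite -integral_normM_expRN_sqr_tail//; apply: eq_integral => u _.
    by rewrite indicE mem_setE in_itv/= andbT sqr_ge0 mulN1r.
  rewrite mule1 => <-.
  rewrite (_ : (fun _ => _) = cst 1)// integral_cst// mul1e.
  rewrite -setXTT/= product_measure1E//.
  have nT : nu setT = 1 by exact: probability_setT.
  by transitivity (nu setT * nu setT); [by []|rewrite nT mule1].
by move=> mg g0; rewrite key// muleA C1 mul1e.
Qed.

Lemma normal_pair_tail (s : R) : (0 <= s)%R ->
  nu2 [set z | s <= z.1 ^+ 2 + z.2 ^+ 2]%R = (expR (- s))%:E.
Proof.
move=> s0.
rewrite (_ : [set z | _] = (fun z : measurableTypeR R * measurableTypeR R =>
    z.1 ^+ 2 + z.2 ^+ 2)%R @^-1` `[s, +oo[); last first.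
  by apply/seteqP; split => z /=; rewrite in_itv/= andbT.
rewrite -[LHS]/(nu2 _) -[X in nu2 X]setIT -integral_indic//; last first.
  by rewrite -[X in measurable X]setTI; exact: sqnorm_measurable.
rewrite (ge0_integral_normal_pair_radial (\1_`[s, +oo[))//.
have := integral_normM_expRN_sqr_tail (R := R) 1 s ltr01 s0.
rewrite divr1 mulN1r => <-; apply: eq_integral => u _.
by rewrite mulN1r.
Qed.

Lemma normal_pair_laplace (k : R) : (0 <= k)%R ->
  \int[nu2]_z (expR (- k * (z.1 ^+ 2 + z.2 ^+ 2)))%:E = ((1 + k)^-1)%:E.
Proof.
move=> k0.
have mg : measurable_fun setT (fun r : R => expR (- k * r)).
  by apply: measurableT_comp => //; exact: measurable_funM.
rewrite (ge0_integral_normal_pair_radial _ mg)//.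
have k1 : (0 < 1 + k)%R by rewrite ltr_pwDl.
have := integral_normM_expRN_sqr_tail (R := R) _ _ k1 (lexx 0%R).
rewrite mulr0 expR0 div1r => <-; apply: eq_integral => u _.
rewrite indicE mem_setE in_itv/= andbT sqr_ge0 mulr1 -expRD.
by congr (_ * expR _)%:E; ring.
Qed.

(** For a fixed first pair the section is an exponential tail; integrating it over that pair leaves
    a Laplace transform. *)
Lemma normal_pairs_tail (k s : R) : (0 <= k)%R -> (0 <= s)%R ->
  (nu2 \x nu2) [set w | s + k * (w.1.1 ^+ 2 + w.1.2 ^+ 2) <=
                      w.2.1 ^+ 2 + w.2.2 ^+ 2]%R
  = (expR (- s) / (1 + k))%:E.
Proof.
move=> k0 s0; set W := [set w | _].
rewrite -[LHS]/(\int[nu2]_z nu2 (xsection W z)).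
transitivity (\int[nu2]_z ((expR (- s))%:E *
    (expR (- k * (z.1 ^+ 2 + z.2 ^+ 2)))%:E)).
  apply: eq_integral => z _.
  rewrite /= -EFinM -expRD mulNr -opprD -normal_pair_tail; last first.
    by rewrite addr_ge0// mulr_ge0// addr_ge0 ?sqr_ge0.
  by congr nu2; apply/seteqP; split => w /=; rewrite /xsection/= inE.
rewrite ge0_integralZl//; last first.
  apply/measurable_EFinP; apply: measurableT_comp => //.
  by apply: measurable_funM => //; exact: sqnorm_measurable.
by rewrite normal_pair_laplace.
Qed.

End complex_gaussian.

(** * Joint laws as product measures *)

Section joint_law.
Context {d d1 d2 : measure_display} {T : measurableType d}
  {T1 : measurableType d1} {T2 : measurableType d2} {R : realType}.
Local Open Scope ereal_scope.

(** A finite measure on a product is determined by its values on rectangles. The side event [E]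
    makes the result iterable: the other variables are confined to [E] while one pair is extended
    from rectangles to all measurable sets. *)
Lemma product_measure_joint_law (P : probability T R)
    (m1 : probability T1 R) (m2 : probability T2 R)
    (Y1 : T -> T1) (Y2 : T -> T2) (E : set T) (p : \bar R) :
  measurable_fun setT Y1 -> measurable_fun setT Y2 -> measurable E ->
  (forall A B, measurable A -> measurable B ->
    P (Y1 @^-1` A `&` Y2 @^-1` B `&` E) = m1 A * m2 B * p) ->
  forall C, measurable C ->
    P ((fun t => (Y1 t, Y2 t)) @^-1` C `&` E) = (m1 \x m2) C * p.
Proof.
move=> mY1 mY2 mE H C mC.
(* Taking both sides of the rectangle to be the whole space identifies [p], which is thereby finite
   and nonnegative. *)
have pE : p = P E.
  have := H setT setT measurableT measurableT.
  by rewrite !preimage_setT !setTI !probability_setT !mul1e.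
rewrite {}pE in H *.
have mY : measurable_fun setT (fun t => (Y1 t, Y2 t)).
  exact: measurable_fun_pair.
have PE0 : (0 <= fine (P E))%R by exact: fine_ge0.
pose m : {measure set (T1 * T2) -> \bar R} :=
  pushforward (mrestr P mE) (fun t => (Y1 t, Y2 t)).
(* The weight [P E] is moved into the second factor, so that the law restricted to [E] is compared
   with a genuine product measure. *)
pose m2E := mscale (NngNum PE0) m2.
have PEE : (fine (P E))%:E = P E by rewrite fineK// fin_num_measure.
transitivity ((m1 \x m2E) C).
  rewrite (@product_measure_unique _ _ _ _ _ m1 m2E (m mY))// => A B mA mB.
  by rewrite /m2E/= /mscale/= PEE /pushforward /mrestr muleCA muleC -H.
rewrite /product_measure1 /= /m2E /mscale/= PEE ge0_integralZl//.
- by rewrite muleC.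
- exact: measurable_fun_xsection.
Qed.

End joint_law.

(** * Independence of the three channels, from that of their six coordinates *)

Section channels.
Context {d : measure_display} {T : measurableType d} {R : realType}.
Context (P : probability T R) (X : 'I_3 * bool -> T -> R).
Context (indepX : indep_CN01 P X).
Local Notation nu := (normal_prob (0 : R) (Num.sqrt 2^-1)).
Local Notation nu2 := (nu \x nu)%E.
Local Open Scope ereal_scope.

Definition channel (i : 'I_3) (t : T) : measurableTypeR R * measurableTypeR R :=
  (X (i, false) t, X (i, true) t).

Let mX k : measurable_fun setT (X k). Proof. by have [[]] := indepX. Qed.

Lemma measurable_channel i : measurable_fun setT (channel i).
Proof.
by apply: (@measurable_fun_pair _ _ _ _
  (measurableTypeR R) (measurableTypeR R)); exact: mX.
Qed.

Let hRD_hSR : (hRD == hSR) = false.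
Proof. by rewrite -val_eqE /= !inordK. Qed.
Let hSE_hSR : (hSE == hSR) = false.
Proof. by rewrite -val_eqE /= !inordK. Qed.
Let hSE_hRD : (hSE == hRD) = false.
Proof. by rewrite -val_eqE /= !inordK. Qed.

Let links_ind (Q : 'I_3 -> Prop) : Q hSR -> Q hRD -> Q hSE -> forall i, Q i.
Proof.
move=> Q0 Q1 Q2 [[|[|[|//]]] i3].
- by rewrite (_ : Ordinal i3 = hSR)//; apply/val_inj; rewrite /= inordK.
- by rewrite (_ : Ordinal i3 = hRD)//; apply/val_inj; rewrite /= inordK.
- by rewrite (_ : Ordinal i3 = hSE)//; apply/val_inj; rewrite /= inordK.
Qed.

Let prod_links (F : 'I_3 -> \bar R) :
  \prod_(i < 3) F i = F hSR * F hRD * F hSE.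
Proof.
rewrite !big_ord_recl big_ord0 mule1 muleA.
by congr (F _ * F _ * F _); apply/val_inj; rewrite /= inordK.
Qed.

Let rect i (A B : set R) := X (i, false) @^-1` A `&` X (i, true) @^-1` B.

Let mrect i A B : measurable A -> measurable B -> measurable (rect i A B).
Proof.
by move=> mA mB; apply: measurableI;
  rewrite -[X in measurable X]setTI; exact: mX.
Qed.

Let mchannelP i C : measurable C -> measurable (channel i @^-1` C).
Proof.
by move=> mC; rewrite -[X in measurable X]setTI; exact: measurable_channel.
Qed.

Let prob_rects (A B : 'I_3 -> set R) :
  (forall i, measurable (A i)) -> (forall i, measurable (B i)) ->
  P (rect hSR (A hSR) (B hSR) `&` rect hRD (A hRD) (B hRD) `&`
     rect hSE (A hSE) (B hSE)) =
  nu (A hSR) * nu (B hSR) * (nu (A hRD) * nu (B hRD)) *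
  (nu (A hSE) * nu (B hSE)).
Proof.
move=> mA mB; have [[_ indep] law] := indepX.
pose F (k : 'I_3 * bool) := if k.2 then B k.1 else A k.1.
have mF k : measurable (F k) by rewrite /F; case: ifP.
have := indep F mF; under eq_bigr do rewrite law//.
rewrite -(pair_bigA _ (fun i b => nu (F (i, b))))/= prod_links !big_bool/= /F/=.
rewrite ![nu (B _) * _]muleC => <-; congr (P _); apply/seteqP; split => t /=.
  move=> [[[? ?] [? ?]] [? ?]] [i b] _; rewrite /F.
  by move: i; apply: links_ind; case: b.
move=> H; split; [split|]; split.
- exact: (H (hSR, false)).
- exact: (H (hSR, true)).
- exact: (H (hRD, false)).
- exact: (H (hRD, true)).
- exact: (H (hSE, false)).
- exact: (H (hSE, true)).
Qed.

Let links_case (U : Type) (x y z : U) (i : 'I_3) :=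
  if i == hSR then x else if i == hRD then y else z.

Let prob_rects_explicit A0 B0 A1 B1 A2 B2 :
  measurable A0 -> measurable B0 -> measurable A1 -> measurable B1 ->
  measurable A2 -> measurable B2 ->
  P (rect hSR A0 B0 `&` rect hRD A1 B1 `&` rect hSE A2 B2) =
  nu A0 * nu B0 * (nu A1 * nu B1) * (nu A2 * nu B2).
Proof.
move=> mA0 mB0 mA1 mB1 mA2 mB2.
have := @prob_rects (links_case _ A0 A1 A2) (links_case _ B0 B1 B2).
rewrite /links_case !eqxx hRD_hSR hSE_hSR hSE_hRD; apply.
- by move=> i; case: ifP => _ //; case: ifP.
- by move=> i; case: ifP => _ //; case: ifP.
Qed.

Let channel_law i (E : set T) (p : \bar R) : measurable E ->
  (forall A B, measurable A -> measurable B ->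
    P (rect i A B `&` E) = nu A * nu B * p) ->
  forall C, measurable C -> P (channel i @^-1` C `&` E) = nu2 C * p.
Proof.
move=> mE H C mC.
apply: (@product_measure_joint_law _ _ _ _ (measurableTypeR R)
  (measurableTypeR R) R P nu nu (X (i, false)) (X (i, true)) E p) => //;
  exact: mX.
Qed.

(** Rectangles are replaced by arbitrary measurable sets one link at a time, (S,R), then (R,D), then
    (S,E); at each stage the events of the other two links form the side event of [channel_law]. *)
Lemma prob_channels C0 C1 C2 :
  measurable C0 -> measurable C1 -> measurable C2 ->
  P (channel hSR @^-1` C0 `&` channel hRD @^-1` C1 `&` channel hSE @^-1` C2) =
  nu2 C0 * nu2 C1 * nu2 C2.
Proof.
move=> mC0 mC1 mC2.
have H0 A1 B1 A2 B2 : measurable A1 -> measurable B1 ->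
    measurable A2 -> measurable B2 ->
    P (channel hSR @^-1` C0 `&` (rect hRD A1 B1 `&` rect hSE A2 B2)) =
    nu2 C0 * (nu A1 * nu B1 * (nu A2 * nu B2)).
  move=> mA1 mB1 mA2 mB2; apply: channel_law => //.
    by apply: measurableI; exact: mrect.
  by move=> A0 B0 mA0 mB0; rewrite setIA prob_rects_explicit// [RHS]muleA.
have H1 A2 B2 : measurable A2 -> measurable B2 ->
    P (channel hRD @^-1` C1 `&` (channel hSR @^-1` C0 `&` rect hSE A2 B2)) =
    nu2 C1 * (nu2 C0 * (nu A2 * nu B2)).
  move=> mA2 mB2; apply: channel_law => //.
    by apply: measurableI; [exact: mchannelP|exact: mrect].
  by move=> A1 B1 mA1 mB1; rewrite setICA H0// [LHS]muleCA.
rewrite setIC muleC; apply: channel_law => //.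
  by apply: measurableI; exact: mchannelP.
move=> A2 B2 mA2 mB2.
rewrite setIC -setIA setICA H1//.
by rewrite [LHS]muleCA [LHS]muleA [LHS]muleC.
Qed.

(* The pair is ordered (S,E), (S,R) so that sections over the eavesdropper's
   channel are upper tails of the legitimate one. *)
Lemma prob_channels_joint C C1 : measurable C -> measurable C1 ->
  P ((fun t => (channel hSE t, channel hSR t)) @^-1` C `&`
     channel hRD @^-1` C1) = (nu2 \x nu2) C * nu2 C1.
Proof.
move=> mC mC1; apply: product_measure_joint_law => //.
- exact: measurable_channel.
- exact: measurable_channel.
- exact: mchannelP.
move=> A B mA mB.
have -> : channel hSE @^-1` A `&` channel hSR @^-1` B `&` channel hRD @^-1` C1 =
  channel hSR @^-1` B `&` channel hRD @^-1` C1 `&` channel hSE @^-1` A.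
  by rewrite -setIA setIC.
have H := prob_channels _ _ _ mB mC1 mA.
rewrite [LHS]H [LHS]muleC [LHS]muleA.
reflexivity.
Qed.

End channels.

(** * The exact outage probability *)

Lemma le_log2 {R : realType} (a y : R) : 0 < y -> (a <= log2 y) = (2 `^ a <= y).
Proof.
move=> y0; rewrite /log2 ler_pdivlMr; last by rewrite ln_gt0// ltr1n.
by rewrite -ler_expR lnK// /powR pnatr_eq0.
Qed.

Lemma powR2_ge1 {R : realType} (a : R) : 0 <= a -> 1 <= 2 `^ a.
Proof. by move=> a0; rewrite -[leLHS](powRr0 2) ler_powR// ler1n. Qed.

(** Outage is the complement of [E], in which [W] constrains the pair (S,E), (S,R) and [V]
    constrains (R,D). The exponents [s] and [c] add up to [(b - 1) * (1 + alpha^-1) / gD]. *)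
Lemma P2E (R : realType) (d : measure_display) (T : measurableType d)
  (P : probability T R) (X : 'I_3 * bool -> T -> R) (Rth alpha beta gD : R) :
  0 < Rth -> 0 < alpha -> 0 < beta -> 0 < gD -> indep_CN01 P X ->
  P2 P Rth alpha beta gD X =
  1 - expR (- ((2 `^ Rth - 1) * (1 + alpha^-1) / gD)) /
      (1 + beta^-1 * 2 `^ Rth).
Proof.
move=> Rth0 a0 be0 g0 indepX.
set b := 2 `^ Rth.
have b1 : 1 <= b by rewrite powR2_ge1// ltW.
have b0 : 0 < b by exact: lt_le_trans b1.
pose s := (b - 1) / (alpha * gD).
pose k := beta^-1 * b.
pose c := (b - 1) / gD.
have s0 : 0 <= s by rewrite divr_ge0 ?subr_ge0// mulr_ge0 ?ltW.
have c0 : 0 <= c by rewrite divr_ge0 ?subr_ge0// ltW.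
have k0 : 0 <= k by rewrite mulr_ge0 ?invr_ge0 ?ltW.
pose W : set ((measurableTypeR R * measurableTypeR R) *
              (measurableTypeR R * measurableTypeR R)) :=
  [set w | s + k * (w.1.1 ^+ 2 + w.1.2 ^+ 2) <= w.2.1 ^+ 2 + w.2.2 ^+ 2].
pose V : set (measurableTypeR R * measurableTypeR R) :=
  [set z | c <= z.1 ^+ 2 + z.2 ^+ 2].
have mV : measurable V.
  have := @measurable_fun_ler _ _ R setT (cst c) _ (measurable_cst _)
    sqnorm_measurable.
  by move=> /(_ measurableT [set true] I); rewrite setTI.
have mW : measurable W.
  have mf : measurable_fun setT
      (fun w : (measurableTypeR R * measurableTypeR R) *
               (measurableTypeR R * measurableTypeR R) =>
        s + k * (w.1.1 ^+ 2 + w.1.2 ^+ 2)).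
    apply: measurable_funD => //; apply: measurable_funM => //.
    exact: (measurableT_comp sqnorm_measurable).
  have mg : measurable_fun setT
      (fun w : (measurableTypeR R * measurableTypeR R) *
               (measurableTypeR R * measurableTypeR R) =>
        w.2.1 ^+ 2 + w.2.2 ^+ 2).
    exact: (measurableT_comp sqnorm_measurable).
  have := measurable_fun_ler mf mg.
  by move=> /(_ measurableT [set true] I); rewrite setTI.
pose E := (fun t => (channel X hSE t, channel X hSR t)) @^-1` W `&`
     channel X hRD @^-1` V.
have PE : P E = (expR (- s) / (1 + k) * expR (- c))%:E.
  by rewrite prob_channels_joint// normal_pairs_tail// normal_pair_tail.
have mE : measurable E.
  have mZ i : measurable_fun setT (channel X i).
    exact: (measurable_channel P).
  apply: measurableI; rewrite -[X in measurable X]setTI; last exact: mZ.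
  exact: (measurable_fun_pair (mZ hSE) (mZ hSR)).
have -> : P2 P Rth alpha beta gD X = fine (P (~` E)).
  congr (fine (P _)); apply/seteqP.
  have hsq0 i t : 0 <= hsq X i t by rewrite addr_ge0 ?sqr_ge0.
  have E1 t : (R2 alpha beta gD X t < Rth) =
    ~~ ((s + k * hsq X hSE t <= hsq X hSR t) && (c <= hsq X hRD t)).
    rewrite ltNge; congr negb.
    rewrite /R2 le_max [Rth <= 0]leNgt Rth0 orbF le_min.
    have gE0 : 0 < 1 + alpha * gD / beta * hsq X hSE t.
      by rewrite ltr_pwDl// !mulr_ge0 ?invr_ge0// ltW.
    have gR0 : 0 < 1 + alpha * gD * hsq X hSR t.
      by rewrite ltr_pwDl// !mulr_ge0// ltW.
    have gD0 : 0 < 1 + gD * hsq X hRD t.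
      by rewrite ltr_pwDl// !mulr_ge0// ltW.
    rewrite !le_log2 ?divr_gt0// -/b ler_pdivlMr//; congr andb.
    (* Multiplying the SNR condition by [alpha * gD] and adding 1 turns its left side into [b] times
       the denominator of the rate, and its right side into the numerator. *)
    + rewrite -[RHS](@ler_pM2l _ (alpha * gD)) ?mulr_gt0// -[RHS](lerD2l 1).
      congr (_ <= _); rewrite /s /k; field.
      by rewrite !gt_eqF.
    + by rewrite /c ler_pdivrMr// lerBlDl mulrC.
  split => t /=.
  + by rewrite E1 => /negP H [H1 H2]; apply: H; apply/andP; split.
  + by move=> H; rewrite E1; apply/negP => /andP[H1 H2]; apply: H; split.
rewrite probability_setC// PE -EFinB/=; congr (1 - _).
rewrite mulrAC -expRD; congr (expR _ / _); rewrite /s /c; field.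
by rewrite !gt_eqF.
Qed.

(** * Limit and first-order term at high SNR *)

Theorem theorem6 (R : realType) (d : measure_display) (T : measurableType d)
  (P : probability T R) (X : 'I_3 * bool -> T -> R)
  (Rth alpha beta : R) :
  0 < Rth -> 0 < alpha -> 0 < beta ->
  indep_CN01 P X ->
  (P2 P Rth alpha beta gD X @[gD --> +oo] --> P2lim Rth beta) /\
  (gD * (P2 P Rth alpha beta gD X - P2lim Rth beta) @[gD --> +oo]
     --> M2hat Rth alpha beta).
Proof.
move=> Rth0 a0 b0 indepX.
rewrite /P2lim /M2hat; set c := (2 `^ Rth - 1) * _; set K := 1 + beta^-1 * _.
have c0 : 0 <= c.
  by rewrite mulr_ge0 ?subr_ge0 ?powR2_ge1 ?addr_ge0 ?invr_ge0//; exact: ltW.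
have K0 : 0 < K.
  by rewrite /K ltr_pwDl// mulr_ge0 ?powR_ge0// invr_ge0 ltW.
have P2c (g : R) : 0 < g -> P2 P Rth alpha beta g X = 1 - expR (- (c / g)) / K.
  by move=> g0; rewrite P2E.
have cvge : expR (- (c / g)) @[g --> +oo] --> (1 : R).
  rewrite -expR0 -oppr0 -(mulr0 c).
  apply: (cvg_comp _ expR); last exact: continuous_expR.
  apply: cvgN; apply: cvgMr; apply/gtr0_cvgV0; last exact: cvg_id.
  by near=> g.
split.
  have : (1 - expR (- (c / g)) / K) @[g --> +oo] --> 1 - 1 / K.
    by apply: cvgB; [exact: cvg_cst|apply: cvgMl].
  apply: cvg_trans; apply: near_eq_cvg.
  by near=> g; rewrite P2c.
(* [y e^-y <= 1 - e^-y <= y] at [y = c / g] *)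
apply: (@squeeze_cvgr _ _ _ _
  (fun g => expR (- (c / g)) * (c / K)) (cst (c / K))).
- near=> g; have g0 : 0 < g by [].
  rewrite P2c// /=.
  have -> : g * (1 - expR (- (c / g)) / K - (1 - 1 / K)) =
    g * (1 - expR (- (c / g))) / K by field; rewrite gt_eqF.
  rewrite mulrA !ler_pM2r ?invr_gt0//.
  (* Writing [c] as [g * (c / g)] lets [g] cancel, leaving inequalities in [y = c / g] alone. *)
  have cgE : c = g * (c / g) by field; rewrite gt_eqF.
  have cg0 : 0 <= c / g by rewrite divr_ge0// ltW.
  apply/andP; split.
    rewrite {2}cgE mulrCA ler_pM2l//.
    (* Multiply [1 + y <= e^y] by [e^-y]. The upper bound below is the same convexity inequality
       taken at [- y]. *)
    have := expR_ge1Dx (c / g); have := expR_gt0 (- (c / g)).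
    have := expRxMexpNx_1 (c / g); nra.
  rewrite {2}cgE ler_pM2l//.
  have := expR_ge1Dx (- (c / g)); lra.
- by rewrite -[X in _ --> X]mul1r; apply: cvgMl.
- exact: cvg_cst.
Unshelve. all: by end_near.
Qed.
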